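(* Let $G=(V,A)$ be a directed graph and $b:\mathcal{P}(V)\to\mathbb{Z}$ an integral submodular function. Let $\kappa^*\in\mathbb{R}$ be such that $s(\kappa^* )=\sigma^*=\min_{\kappa\in\mathbb{R}}s(\kappa)$. Then the minimum spread $\sigma_I^*$ of an integral submodular flow can be computed as $$\sigma_I^*=\min\left\{s_I(\lfloor\kappa^*\rfloor),\,s_I(\lceil\kappa^*\rceil)\right\}=\min\left\{\lceil s(\lfloor\kappa^*\rfloor)\rceil,\,\lceil s(\lceil\kappa^*\rceil)\rceil\right\}.$$
   Context: $G=(V,A)$ is a finite directed graph and $\mathcal{P}(V)$ is the power set of $V$. The function $b$ is submodular if $b(X)+b(Y)\ge b(X\cup Y)+b(X\cap Y)$ for all $X,Y\subseteq V$. For $x\in\mathbb{R}^A$ and $X\subseteq V$, $\varrho_x(X)$ and $\delta_x(X)$ denote the sum of $x(e)$ over the edges $e$ entering, resp. leaving, $X$. A submodular flow is a vector $x\in\mathbb{R}^A$ with $\varrho_x(X)-\delta_x(X)\le b(X)$ for every $X\subseteq V$; it is $(l,u)$-bounded if $l\le x\le u$. The spread of $x$ is $\sigma(x):=\max_{a\in A}x(a)-\min_{a\in A}x(a)$. With $\mathbf 1$ the all-ones vector in $\mathbb{R}^A$: for $\kappa\in\mathbb{R}$, $s(\kappa)$ is the minimum $\sigma\ge 0$ for which there exists a $(\kappa\mathbf 1,(\kappa+\sigma)\mathbf 1)$-bounded submodular flow; for $\kappa\in\mathbb{Z}$, $s_I(\kappa)$ is the minimum $\sigma\ge 0$ for which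 there exists a $(\kappa\mathbf 1,(\kappa+\sigma)\mathbf 1)$-bounded integral submodular flow $x\in\mathbb{Z}^A$ (both are $+\infty$ if no such flow exists for any $\sigma$, with $\lceil+\infty\rceil=+\infty$). $\sigma^*$ is the minimum spread over all submodular flows and $\sigma_I^*$ is the minimum spread over all integral submodular flows $x\in\mathbb{Z}^A$. Standing assumptions: $G$ has no isolated vertex, and a submodular flow exists, i.e. $b(U)\ge0$ for every $U\subseteq V$ that no edge enters or leaves. *)

(* Defs.v *)
From HB Require Import structures.
From mathcomp Require Import all_boot all_order all_algebra.
From mathcomp Require Import all_classical all_reals.

Set Implicit Arguments.
Unset Strict Implicit.
Unset Printing Implicit Defensive.

Import Order.TTheory GRing.Theory Num.Theory.
Local Open Scope classical_set_scope.
Local Open Scope ring_scope.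

Section Minimum.
Context {R : realType}.

(* [+oo] when [S] has no least element, in particular when [S] is empty.
   Unlike [ereal_inf], a finite value is always attained. *)
Definition minimum (S : set (\bar R)) : \bar R :=
  xget +oo%E (S `&` lbound S).

Lemma minimum_eq (S : set (\bar R)) (m : \bar R) :
  S m -> lbound S m -> minimum S = m.
Proof.
move=> Sm lm; apply: xget_unique => // y [Sy ly].
by apply/eqP; rewrite eq_le ly // lm.
Qed.

Lemma minimum_set0 : minimum set0 = +oo%E.
Proof. by rewrite /minimum set0I xgetPN // => x []. Qed.

Definition eceil (y : \bar R) : \bar R :=
  er_map (fun r : R => (Num.ceil r)%:~R) y.

End Minimum.

(* Parallel edges and loops are allowed; a loop enters and leaves no set. *)
Section SubmodularFlow.
Context {R : realType} {V A : finType}.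
Variables (src tgt : A -> V) (b : {set V} -> int).

Definition submodular : Prop :=
  forall X Y : {set V}, b (X :|: Y) + b (X :&: Y) <= b X + b Y.

Definition no_isolated_vertex : Prop :=
  forall v : V, exists e : A, src e = v \/ tgt e = v.

Definition rho (x : A -> R) (X : {set V}) : R :=
  \sum_(e : A | (src e \notin X) && (tgt e \in X)) x e.

Definition delta (x : A -> R) (X : {set V}) : R :=
  \sum_(e : A | (src e \in X) && (tgt e \notin X)) x e.

Definition submodular_flow : set (A -> R) :=
  [set x | forall X : {set V}, rho x X - delta x X <= (b X)%:~R].

Definition integral_vector : set (A -> R) :=
  [set x | forall e : A, x e \is a Num.int].

Definition bounded_by (l u : A -> R) : set (A -> R) :=
  [set x | forall e : A, l e <= x e <= u e].

(* The index [x a0] is neutral here since [a0] is itself an edge.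
   If there is no edge, the spread is taken to be 0. *)
Definition spread (x : A -> R) : R :=
  if [pick a0 : A] is Some a0 then
    \big[Num.max/x a0]_(a : A) x a - \big[Num.min/x a0]_(a : A) x a
  else 0.

Definition s (kappa : R) : \bar R :=
  minimum [set sigma%:E | sigma in [set sigma : R | 0 <= sigma /\
    (submodular_flow `&`
       bounded_by (fun=> kappa) (fun=> kappa + sigma)) !=set0]].

Definition s_I (kappa : int) : \bar R :=
  minimum [set sigma%:E | sigma in [set sigma : R | 0 <= sigma /\
    (submodular_flow `&` integral_vector `&`
       bounded_by (fun=> kappa%:~R) (fun=> kappa%:~R + sigma)) !=set0]].

Definition sigma_star : \bar R :=
  minimum [set (spread x)%:E | x in submodular_flow].

Definition sigma_I_star : \bar R :=
  minimum [set (spread x)%:E | x in submodular_flow `&` integral_vector].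

End SubmodularFlow.

Arguments s_I R {V A} src tgt b kappa.
Arguments sigma_star R {V A} src tgt b.
Arguments sigma_I_star R {V A} src tgt b.
Arguments submodular_flow R {V A} src tgt b.

(* Main.v *)
Require Import Defs.
From HB Require Import structures.
From mathcomp Require Import all_boot all_order all_algebra.
From mathcomp Require Import all_classical all_reals.
From mathcomp Require Import lra.

Set Implicit Arguments.
Unset Strict Implicit.
Unset Printing Implicit Defensive.

Import Order.TTheory GRing.Theory Num.Theory.
Local Open Scope classical_set_scope.
Local Open Scope ring_scope.

(** The key is the feasibility theorem for submodular flows
    ([bounded_flow_exists]): for [l <= u], an [(l, u)]-bounded submodular flow
    exists as soon as [rho l X - delta u X <= b X] for every [X], and it can be
    taken integral when [l] and [u] are.  The edges are given their final values
    one after the other; the admissible values of one edge form an interval with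
    integral end points, which is nonempty because [X |-> rho l X - delta u X]
    is supermodular and [b] is submodular.

    For the bounds [kappa] and [kappa + sigma] the cut condition is a finite
    system of linear inequalities in the two unknowns [kappa] and [sigma].
    Several facts follow.
    - The least [sigma] for a given [kappa] is attained or no [sigma] is
      feasible ([sP]), and the least [sigma] over all [kappa] is attained too
      ([least_width]); hence the optimal value [s kappa] is finite.
    - For an integer [k], rounding [s k] up keeps the cut condition true, so an
      integral flow exists with that width: [s_I k] is the ceiling of [s k]
      ([s_I_eceil]).
    - For a fixed [sigma] the feasible [kappa] form an interval
      ([width_ok_between]).

    Now let [x] be an integral flow of spread [d], and [k] its least entry.  The
    pair [(k, d)] is feasible, and so is [(kappa, d)], because [d] is at least
    the optimal real width.  Whichever of the floor and the ceiling of [kappa]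
    lies between [k] and [kappa] is then feasible for the integer width [d],
    which therefore bounds the corresponding value of [s_I].  Conversely a flow
    attaining [s_I k] has spread at most [s_I k]. *)

(** * Feasibility of submodular flows within bounds *)

Section Feasibility.
Context {R : realType} {V A : finType}.
Variables (src tgt : A -> V) (b : {set V} -> int).

Definition enters (e : A) (X : {set V}) := (src e \notin X) && (tgt e \in X).
Definition leaves (e : A) (X : {set V}) := (src e \in X) && (tgt e \notin X).

(** The least net inflow into [X] that the bounds allow. *)
Definition demand (l u : A -> R) (X : {set V}) : R :=
  rho src tgt l X - delta src tgt u X.

Definition cut_condition (l u : A -> R) : Prop :=
  forall X, demand l u X <= (b X)%:~R.

Definition edge_demand (l u : A -> R) (X : {set V}) (e : A) : R :=
  (if enters e X then l e else 0) - (if leaves e X then u e else 0).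

Lemma demandE l u X : demand l u X = \sum_e edge_demand l u X e.
Proof.
by rewrite /edge_demand sumrB -big_mkcond -(big_mkcond (fun e => leaves e X)).
Qed.

Lemma demand_int l u X :
  (forall e, l e \is a Num.int) -> (forall e, u e \is a Num.int) ->
  demand l u X \is a Num.int.
Proof. by move=> li ui; rewrite rpredB // rpred_sum. Qed.

Lemma cut_condition_widen (l u l' u' : A -> R) :
  (forall e, l' e <= l e) -> (forall e, u e <= u' e) ->
  cut_condition l u -> cut_condition l' u'.
Proof.
move=> ll uu H X; apply: le_trans (H X).
by rewrite lerB // ler_sum.
Qed.

(** An edge counted on the left only is one that joins [X :\: Y] to [Y :\: X];
    it contributes [l e - u e <= 0] there.  All other edges count equally on
    both sides. *)
Lemma edge_demand_supermodular l u X Y e : l e <= u e ->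
  edge_demand l u X e + edge_demand l u Y e <=
  edge_demand l u (X :|: Y) e + edge_demand l u (X :&: Y) e.
Proof.
rewrite /edge_demand /enters /leaves !inE => lu.
by case: (src e \in X); case: (src e \in Y); case: (tgt e \in X);
   case: (tgt e \in Y) => /=; lra.
Qed.

(** An edge that enters [X] and leaves [Y] goes from [Y :\: X] to [X :\: Y], so
    it is absent from the right-hand side and contributes [l e - u e] to the
    left-hand side.  The gap [u e - l e] is what makes the lower bounds on the
    value of [e] compatible with the upper bounds in [fix_edge]. *)
Lemma demand_supermodular_gap l u X Y e : (forall a, l a <= u a) ->
  enters e X -> leaves e Y ->
  demand l u X + demand l u Y + (u e - l e) <=
  demand l u (X :|: Y) + demand l u (X :&: Y).
Proof.
move=> lu eX eY; rewrite !demandE -!big_split /=.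
rewrite (bigD1 e) //= [leRHS](bigD1 e) //=.
have -> : edge_demand l u X e + edge_demand l u Y e = l e - u e.
  move: eX eY; rewrite /edge_demand /enters /leaves.
  by case: (src e \in X); case: (src e \in Y); case: (tgt e \in X);
     case: (tgt e \in Y) => //= _ _; rewrite subr0 sub0r.
have -> : edge_demand l u (X :|: Y) e + edge_demand l u (X :&: Y) e = 0.
  move: eX eY; rewrite /edge_demand /enters /leaves !inE.
  by case: (src e \in X); case: (src e \in Y); case: (tgt e \in X);
     case: (tgt e \in Y) => //= _ _; rewrite subr0 addr0.
rewrite addrAC addrC -[l e - u e]opprB addNr addr0 add0r.
by apply: ler_sum => a _; apply: edge_demand_supermodular.
Qed.

Definition set_edge (x : A -> R) e c := fun a => if a == e then c else x a.

Lemma demand_set_edge l u X e c :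
  demand (set_edge l e c) (set_edge u e c) X =
  demand l u X + ((if enters e X then c - l e else 0)
                  - (if leaves e X then c - u e else 0)).
Proof.
rewrite !demandE (bigD1 e) //= [in RHS](bigD1 e) //=.
rewrite (eq_bigr (edge_demand l u X)); last first.
  by move=> a /negPf ae; rewrite /edge_demand /set_edge ae.
rewrite /edge_demand /set_edge eqxx.
by case: (enters e X); case: (leaves e X); lra.
Qed.

(** A set [Y] that [e] leaves forces the value of [e] to be at least
    [demand l u Y + u e - b Y], and a set [X] that [e] enters forces it to be at
    most [b X - demand l u X + l e].  Uncrossing [X] and [Y] shows that each of
    these lower bounds is below each upper bound, so the largest lower bound
    will do; it is integral when the data are. *)
Lemma fix_edge l u e : submodular b -> (forall a, l a <= u a) ->
  cut_condition l u ->
  exists c, [/\ l e <= c <= u e,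
    cut_condition (set_edge l e c) (set_edge u e c)
    & (forall a, l a \is a Num.int) -> (forall a, u a \is a Num.int) ->
      c \is a Num.int].
Proof.
move=> sm lu cut.
pose low Y := demand l u Y + u e - (b Y)%:~R.
exists (\big[Num.max/l e]_(Y | leaves e Y) low Y); set c := bigop.body _ _ _.
have lc : l e <= c by apply: bigmax_ge_id.
have cu : c <= u e.
  apply: bigmax_le => // Y _; have := cut Y; rewrite /low; lra.
have cX X : enters e X -> c <= (b X)%:~R - demand l u X + l e.
  move=> eX; apply: bigmax_le => [|Y eY]; first by have := cut X; lra.
  have := demand_supermodular_gap lu eX eY.
  have := cut (X :|: Y); have := cut (X :&: Y).
  have : (b (X :|: Y))%:~R + (b (X :&: Y))%:~R <= (b X)%:~R + (b Y)%:~R :> R.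
    by rewrite -!intrD ler_int.
  rewrite /low; lra.
have cY Y : leaves e Y -> low Y <= c by move=> eY; apply: le_bigmax_cond.
split; first by rewrite lc.
- move=> X; rewrite demand_set_edge.
  have := cX X; have := cY X; have := cut X; rewrite /low /enters /leaves.
  by case: (src e \in X); case: (tgt e \in X) => /= ? cYX cXX;
    try (have := cYX isT); try (have := cXX isT); lra.
- move=> li ui; apply: (big_ind (fun x => x \is a Num.int)) => //.
    by move=> x y; rewrite maxEle; case: ifP.
  move=> Y _; rewrite /low rpredB ?intr_int // rpredD //; exact: demand_int.
Qed.

Lemma fix_edges l u (r : seq A) : submodular b -> (forall a, l a <= u a) ->
  cut_condition l u ->
  exists l' u', [/\ forall a, [/\ l a <= l' a, l' a <= u' a & u' a <= u a],
    cut_condition l' u', {in r, l' =1 u'}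
    & (forall a, l a \is a Num.int) -> (forall a, u a \is a Num.int) ->
      forall a, (l' a \is a Num.int) && (u' a \is a Num.int)].
Proof.
move=> sm lu cut; elim: r => [|e r [l' [u' [bd cut' eqr li]]]].
  by exists l, u; split=> // li ui a; rewrite li ui.
have lu' a : l' a <= u' a by case: (bd a).
have [c [/andP[lc cu] cutc ci]] := fix_edge e sm lu' cut'.
exists (set_edge l' e c), (set_edge u' e c); split=> //.
- move=> a; have [la _ ua] := bd a; rewrite /set_edge; case: eqP => // ae.
  by subst a; split=> //; [apply: le_trans lc|apply: le_trans ua].
- move=> a; rewrite inE /set_edge; case: eqP => //= _; exact: eqr.
- move=> hl hu a; have := li hl hu a; rewrite /set_edge; case: eqP => // _ _.
  by rewrite ci // => d; case/andP: (li hl hu d).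
Qed.

(** Once every edge is fixed, both bounds agree, and the cut condition then says
    that their common value is a submodular flow. *)
Theorem bounded_flow_exists l u : submodular b -> (forall a, l a <= u a) ->
  cut_condition l u ->
  exists x, [/\ submodular_flow R src tgt b x, bounded_by l u x
    & (forall a, l a \is a Num.int) -> (forall a, u a \is a Num.int) ->
      integral_vector x].
Proof.
move=> sm lu /(fix_edges (enum A) sm lu) [x [y [bd cut xy xi]]].
have {xy} yx : y = x by apply/funext => a; rewrite xy // mem_enum.
subst y; exists x; split=> //; first by move=> a; case: (bd a) => -> _ ->.
by move=> li ui a; case/andP: (xi li ui a).
Qed.

Lemma bounded_flow_cut l u x : submodular_flow R src tgt b x ->
  bounded_by l u x -> cut_condition l u.
Proof. by move=> fx bx; apply: cut_condition_widen fx => e; case/andP: (bx e). Qed.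

End Feasibility.

(** * Minima of linear systems in one and two unknowns *)

Lemma minimumPn (R : realType) (S : set (\bar R)) :
  ~ (exists2 m, S m & lbound S m) -> minimum S = +oo%E.
Proof. by move=> H; rewrite /minimum xgetPN // => m [Sm lm]; apply: H; exists m. Qed.

(** The candidate [t] is the largest of [0] and the lower bounds coming from the
    positive coefficients.  It satisfies the constraints with a nonpositive
    coefficient because it is below some feasible point. *)
Lemma linear_system_min (R : realFieldType) (I : finType) (a c : I -> R) :
  (exists2 t, 0 <= t & forall i, c i <= a i * t) ->
  exists t, [/\ 0 <= t, forall i, c i <= a i * t
    & forall t', 0 <= t' -> (forall i, c i <= a i * t') -> t <= t'].
Proof.
move=> [t0 t00 ct0].
pose t := \big[Num.max/0]_(i | 0 < a i) (c i / a i).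
have tmin t' : 0 <= t' -> (forall i, c i <= a i * t') -> t <= t'.
  move=> t'0 ct'; apply: bigmax_le => // i ai.
  by rewrite ler_pdivrMr // mulrC ct'.
exists t; split=> //; first exact: bigmax_ge_id.
move=> i; have [ai|ai] := ltP 0 (a i).
  by rewrite mulrC -ler_pdivrMr //; apply: le_bigmax_cond.
by apply: le_trans (ct0 i) _; rewrite ler_wnM2l // tmin.
Qed.

(** Lower bounds [q j / p j] and upper bounds [q i / p i] on a number leave room
    for it when each lower bound is below each upper bound. *)
Lemma interval_system (R : realFieldType) (I : finType) (p q : I -> R) :
  (forall i, p i = 0 -> 0 <= q i) ->
  (forall i j, 0 < p i -> p j < 0 -> p j * q i <= p i * q j) ->
  exists k, forall i, p i * k <= q i.
Proof.
move=> H0 H.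
(* The start value [up] takes care of the case without lower bounds. *)
pose up := \big[Num.min/0]_(i | 0 < p i) (q i / p i).
exists (\big[Num.max/up]_(j | p j < 0) (q j / p j)) => i.
have [pi|pi|pi] := ltgtP (p i) 0.
- rewrite -ler_ndivrMl // mulrC; exact: le_bigmax_cond.
- rewrite -ler_pdivlMl // mulrC; apply: bigmax_le; first exact: bigmin_le_cond.
  move=> j pj; rewrite ler_pdivlMr // mulrAC ler_ndivrMr //.
  by rewrite [q i * _]mulrC [q j * _]mulrC H.
- by rewrite pi mul0r H0.
Qed.

(** Fourier-Motzkin elimination of [k] leaves a system in [t] alone, to which
    [linear_system_min] applies. *)
Lemma linear_system_min2 (R : realFieldType) (I : finType) (p q r : I -> R) :
  (exists k t, 0 <= t /\ forall i, p i * k <= q i + r i * t) ->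
  exists k t, [/\ 0 <= t, forall i, p i * k <= q i + r i * t
    & forall k' t', 0 <= t' -> (forall i, p i * k' <= q i + r i * t') ->
      t <= t'].
Proof.
move=> ex.
(* Inequality [(i, j)] of the eliminated system: constraint [i] alone when
   [k] does not occur in it, and the comparison of the lower bound [j] with the
   upper bound [i] when the signs are right; otherwise it is trivial. *)
pose c (ij : I * I) := let: (i, j) := ij in
  if p i == 0 then - q i else
  if (0 < p i) && (p j < 0) then p j * q i - p i * q j else 0.
pose a (ij : I * I) := let: (i, j) := ij in
  if p i == 0 then r i else
  if (0 < p i) && (p j < 0) then p i * r j - p j * r i else 0.
have elim k t : (forall i, p i * k <= q i + r i * t) ->
    forall ij, c ij <= a ij * t.
  move=> H [i j]; rewrite /c /a; case: eqP => [pi|_].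
    by have := H i; rewrite pi; lra.
  case: ifP => [/andP[pi pj]|_]; last by rewrite mul0r.
  have h1 : p j * (q i + r i * t) <= p j * (p i * k) by rewrite ler_wnM2l ?H ?ltW.
  have h2 : p i * (p j * k) <= p i * (q j + r j * t) by rewrite ler_wpM2l ?H ?ltW.
  have h3 : p j * (p i * k) = p i * (p j * k) by rewrite mulrCA.
  by rewrite h3 in h1; have := le_trans h1 h2; lra.
have [|t [t0 ct tmin]] := @linear_system_min _ _ a c.
  by have [k [t [t0 H]]] := ex; exists t => //; apply: elim H.
have [||k kP] := @interval_system _ _ p (fun i => q i + r i * t).
- by move=> i pi; have := ct (i, i); rewrite /c /a pi eqxx; lra.
- move=> i j pi pj; have := ct (i, j).
  by rewrite /c /a (gt_eqF pi) pi pj /=; lra.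
exists k, t; split=> // k' t' t'0 /elim; exact: tmin.
Qed.

(** * Spread and uniform bounds *)

Section Spread.
Context {R : realType} {A : finType}.
Implicit Types x : A -> R.

Lemma spread_le x (kappa sigma : R) : 0 <= sigma ->
  bounded_by (fun=> kappa) (fun=> kappa + sigma) x -> spread x <= sigma.
Proof.
move=> s0 bx; rewrite /spread; case: pickP => // a0 _.
set mn := \big[Num.min/_]_a _.
have k_mn : kappa <= mn.
  by apply: le_bigmin => [|e _]; [case/andP: (bx a0)|case/andP: (bx e)].
have x_mn a : x a <= sigma + mn.
  by case/andP: (bx a) => _ /le_trans -> //; rewrite addrC lerD2l.
by rewrite lerBlDr; apply: bigmax_le.
Qed.

Lemma spread_bounds x : exists kappa,
  [/\ 0 <= spread x, bounded_by (fun=> kappa) (fun=> kappa + spread x) x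
    & integral_vector x -> kappa \is a Num.int /\ spread x \is a Num.int].
Proof.
rewrite /spread; case: pickP => [a0 _|A0]; last first.
  by exists 0; split=> // a; have := A0 a.
set mx := \big[Num.max/_]_a _; set mn := \big[Num.min/_]_a _.
have mnx a : mn <= x a by apply: bigmin_le.
have xmx a : x a <= mx by apply: le_bigmax.
exists mn; split.
- by rewrite subr_ge0 (le_trans (mnx a0)).
- by move=> a /=; rewrite mnx addrC subrK xmx.
- move=> xi; have mni : mn \is a Num.int.
    by apply: (big_ind (fun y => y \is a Num.int)) => // y z; rewrite minEle; case: ifP.
  split=> //; rewrite rpredB //.
  by apply: (big_ind (fun y => y \is a Num.int)) => // y z; rewrite maxEle; case: ifP.
Qed.

End Spread.

Section UniformBounds.
Context {R : realType} {V A : finType}.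
Variables (src tgt : A -> V) (b : {set V} -> int).
Context (b_submod : submodular b).

(** For [0 <= sigma] this is, by [width_okP], the existence of a flow with values in
    [[kappa, kappa + sigma]]. *)
Definition width_ok (kappa sigma : R) : Prop :=
  cut_condition src tgt b (fun=> kappa) (fun=> kappa + sigma).

Definition indeg X : R := #|[pred e | enters src tgt e X]|%:R.
Definition outdeg X : R := #|[pred e | leaves src tgt e X]|%:R.

Lemma width_okE kappa sigma : width_ok kappa sigma <->
  forall X, (indeg X - outdeg X) * kappa <= (b X)%:~R + outdeg X * sigma.
Proof.
have E X : demand src tgt (fun=> kappa) (fun=> kappa + sigma) X =
    (indeg X - outdeg X) * kappa - outdeg X * sigma.
  rewrite /demand /rho /delta !sumr_const -[kappa *+ _]mulr_natr.
  by rewrite -[(kappa + sigma) *+ _]mulr_natr -/(indeg X) -/(outdeg X); lra.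
by split=> H X; have := H X; rewrite E lerBlDr.
Qed.

Lemma width_ok_widen kappa sigma kappa' sigma' :
  kappa' <= kappa -> kappa + sigma <= kappa' + sigma' ->
  width_ok kappa sigma -> width_ok kappa' sigma'.
Proof. by move=> h1 h2; apply: cut_condition_widen. Qed.

(** At fixed width, each cut inequality is linear in [kappa]. *)
Lemma width_ok_between kappa1 kappa2 kappa sigma :
  kappa1 <= kappa <= kappa2 ->
  width_ok kappa1 sigma -> width_ok kappa2 sigma -> width_ok kappa sigma.
Proof.
move=> /andP[k1 k2] /width_okE H1 /width_okE H2; apply/width_okE => X.
have [d0|/ltW d0] := leP 0 (indeg X - outdeg X).
  by apply: le_trans (H2 X); rewrite ler_wpM2l.
by apply: le_trans (H1 X); rewrite ler_wnM2l.
Qed.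

Lemma width_okP kappa sigma : 0 <= sigma -> width_ok kappa sigma <->
  (submodular_flow R src tgt b `&`
     bounded_by (fun=> kappa) (fun=> kappa + sigma)) !=set0.
Proof.
move=> s0; split=> [ok|[x [fx bx]]]; last exact: bounded_flow_cut fx bx.
have [a|x [fx bx _]] := bounded_flow_exists b_submod _ ok; first by rewrite lerDl.
by exists x.
Qed.

Lemma integral_flow_exists (k n : int) : 0 <= n -> width_ok k%:~R n%:~R ->
  (submodular_flow R src tgt b `&` integral_vector `&`
     bounded_by (fun=> k%:~R) (fun=> k%:~R + n%:~R)) !=set0.
Proof.
move=> n0 ok.
have [a|x [fx bx xi]] := bounded_flow_exists b_submod _ ok.
  by rewrite lerDl ler0z.
by exists x; split=> //; split=> //; apply: xi => a; rewrite ?rpredD ?intr_int.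
Qed.

(** Case analysis on [s kappa]: a finite value is feasible and least, and the
    infinite value occurs only if no width is feasible. *)
Variant s_spec (kappa : R) : \bar R -> Prop :=
| S_finite t of 0 <= t & width_ok kappa t
    & (forall t', 0 <= t' -> width_ok kappa t' -> t <= t') :
    s_spec kappa t%:E
| S_infinite of (forall t, 0 <= t -> ~ width_ok kappa t) :
    s_spec kappa +oo%E.

Lemma sP kappa : s_spec kappa (s src tgt b kappa).
Proof.
have [[t0 t00 ok0]|no] := pselect (exists2 t, 0 <= t & width_ok kappa t).
- have sysE t : width_ok kappa t <->
      forall X, (indeg X - outdeg X) * kappa - (b X)%:~R <= outdeg X * t.
    by rewrite width_okE; split=> H X; have := H X; rewrite lerBlDl.
  have [|t [t0' /sysE okt tmin]] := @linear_system_min R _ outdeg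
      (fun X => (indeg X - outdeg X) * kappa - (b X)%:~R).
    by exists t0 => //; apply/sysE.
  have {}tmin t' : 0 <= t' -> width_ok kappa t' -> t <= t'.
    by move=> t'0 /sysE; apply: tmin.
  have -> : s src tgt b kappa = t%:E; last by constructor.
  apply: minimum_eq; first by exists t => //; split=> //; apply/width_okP.
  move=> _ [t' [t'0 /(width_okP _ t'0) okt'] <-].
  by rewrite lee_fin tmin.
- have -> : s src tgt b kappa = +oo%E.
    apply: minimumPn => -[m [t [t0 /(width_okP _ t0) okt] _] _].
    by apply: no; exists t.
  by constructor=> t t0 okt; apply: no; exists t.
Qed.

Variant s_I_spec (k : int) : \bar R -> Prop :=
| SI_finite (n : int) of 0 <= n & width_ok k%:~R n%:~R
    & (forall m : int, 0 <= m -> width_ok k%:~R m%:~R -> n <= m) :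
    s_I_spec k n%:~R%:E
| SI_infinite of (forall t, 0 <= t -> ~ width_ok k%:~R t) :
    s_I_spec k +oo%E.

(** A flow whose entries are integers in [[k, k + t']] has them in
    [[k, k + floor t']], so [t' >= floor t' >= s k]; as [floor t'] is an integer,
    it is at least the ceiling of [s k]. *)
Lemma s_I_eceil (k : int) : s_I R src tgt b k = eceil (s src tgt b k%:~R).
Proof.
case: sP => [t t0 okt tmin|no] /=; last first.
  apply: minimumPn => -[m [t [t0 [x [[fx _] bx]]] _] _].
  by apply: (no t t0); apply: bounded_flow_cut fx bx.
have c0 : (0 : R) <= (Num.ceil t)%:~R by apply: le_trans (ceil_ge t).
apply: minimum_eq.
  exists (Num.ceil t)%:~R => //; split=> //.
  apply: integral_flow_exists; first by rewrite -(ler0z R).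
  by apply: width_ok_widen okt => //; rewrite lerD2l ceil_ge.
move=> _ [t' [t'0 [x [[fx xi] bx]]] <-]; rewrite lee_fin.
suff: t <= (Num.floor t')%:~R.
  by rewrite -ceil_le_int -(ler_int R) => /le_trans; apply; apply: floor_le.
apply: tmin; first by rewrite ler0z floor_ge0.
apply: bounded_flow_cut fx _ => a; have /andP[-> /= xt] := bx a.
have /intrP[z xz] := xi a; move: xt; rewrite xz.
by rewrite -!lerBlDl -intrB ler_int floor_ge_int.
Qed.

Lemma s_IP k : s_I_spec k (s_I R src tgt b k).
Proof.
rewrite s_I_eceil; case: sP => [t t0 okt tmin|no] /=; last by constructor.
constructor.
- by rewrite -(ler0z R) (le_trans t0) // ceil_ge.
- by apply: width_ok_widen okt => //; rewrite lerD2l ceil_ge.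
- by move=> m m0 okm; rewrite ceil_le_int tmin // ler0z.
Qed.

Lemma least_width : submodular_flow R src tgt b !=set0 ->
  exists kappa sigma, [/\ 0 <= sigma, width_ok kappa sigma
    & forall kappa' sigma', 0 <= sigma' -> width_ok kappa' sigma' ->
      sigma <= sigma'].
Proof.
move=> [x fx].
have [|k [t [t0 /width_okE okt tmin]]] := @linear_system_min2 R _
    (fun X => indeg X - outdeg X) (fun X => (b X)%:~R) outdeg.
  have [k [s0 bx _]] := spread_bounds x.
  exists k, (spread x); split=> //; apply/width_okE.
  exact: bounded_flow_cut fx bx.
by exists k, t; split=> // k' t' t'0 /width_okE; apply: tmin.
Qed.

End UniformBounds.

(** * Integral minimum spread *)

Theorem claim5p3 (R : realType) (V A : finType) (src tgt : A -> V)
    (b : {set V} -> int)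
    (b_submod : submodular b)
    (no_isolated : no_isolated_vertex src tgt)
    (flow_exists : submodular_flow R src tgt b !=set0)
    (kappa : R)
    (s_kappa : s src tgt b kappa = sigma_star R src tgt b)
    (sigma_star_min : sigma_star R src tgt b = minimum (range (s src tgt b))) :
  sigma_I_star R src tgt b =
    mine (s_I R src tgt b (Num.floor kappa)) (s_I R src tgt b (Num.ceil kappa)) /\
  mine (s_I R src tgt b (Num.floor kappa)) (s_I R src tgt b (Num.ceil kappa)) =
    mine (eceil (s src tgt b (Num.floor kappa)%:~R))
         (eceil (s src tgt b (Num.ceil kappa)%:~R)).
Proof.
split; last by rewrite !s_I_eceil.
have [k0 [d0 [d00 ok0 d0min]]] := least_width flow_exists.
have sE : s src tgt b kappa = d0%:E.
  rewrite s_kappa sigma_star_min; apply: minimum_eq.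
    exists k0 => //; case: sP => // [t t0 okt tmin|/(_ d0 d00)//].
    by congr _%:E; apply/eqP; rewrite eq_le tmin // (d0min k0 t).
  move=> _ [k _ <-]; case: sP => // [t t0 okt _|_]; last by rewrite leey.
  by rewrite lee_fin (d0min k t).
(* As [s kappa] is the least width [d0], it is attained at [kappa]. *)
have {sE} okk : width_ok src tgt b kappa d0.
  by move: sE; case: sP => // t _ okt _ [<-].
have [floor_k ceil_k] := (floor_le kappa, ceil_ge kappa).
set m := mine _ _.
have m_le x : submodular_flow R src tgt b x -> integral_vector x ->
    (m <= (spread x)%:E)%E.
  move=> fx xi; have [y [spr0 bx /(_ xi)[]]] := spread_bounds x.
  move=> /intrP[k yk] /intrP[d dE]; subst y; rewrite dE in spr0 bx *.
  have okkd : width_ok src tgt b (k%:~R : R) d%:~R by exact: bounded_flow_cut fx bx.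
  have okd : width_ok src tgt b kappa d%:~R.
    by apply: width_ok_widen okk => //; rewrite lerD2l (d0min k%:~R).
  rewrite ge_min; have [kk|/ltW kk] := leP k%:~R kappa; apply/orP; [left|right].
  - have okf : width_ok src tgt b ((Num.floor kappa)%:~R : R) d%:~R.
      by apply: width_ok_between okkd okd; rewrite ler_int floor_ge_int kk.
    case: s_IP => // [n n0 _ nmin|/(_ _ spr0)//].
    by rewrite lee_fin ler_int nmin // -(ler0z R).
  - have okc : width_ok src tgt b ((Num.ceil kappa)%:~R : R) d%:~R.
      by apply: width_ok_between okd okkd; rewrite ceil_k ler_int ceil_le_int.
    case: s_IP => // [n n0 _ nmin|/(_ _ spr0)//].
    by rewrite lee_fin ler_int nmin // -(ler0z R).
(* The minimum is finite, since lowering [kappa] to its floor preserves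
   feasibility when the upper bound is kept. *)
have [k [n [n0 okn mE]]] : exists k n : int, [/\ 0 <= n,
    width_ok src tgt b (k%:~R : R) n%:~R & m = n%:~R%:E].
  have okf : width_ok src tgt b ((Num.floor kappa)%:~R : R)
      (d0 + (kappa - (Num.floor kappa)%:~R)).
    by apply: width_ok_widen okk => //; lra.
  rewrite /m; case: s_IP => // [n n0 okn _|/(_ (d0 + (kappa - (Num.floor kappa)%:~R)))];
    last by case=> //; lra.
  case: s_IP => // [n' n'0 okn' _|_]; rewrite minEle.
    by case: ifP => _; [exists (Num.floor kappa), n|exists (Num.ceil kappa), n'].
  by rewrite leey; exists (Num.floor kappa), n.
have [x [[fx xi] bx]] := integral_flow_exists b_submod n0 okn.
apply: minimum_eq; last by move=> _ [y [fy yi] <-]; apply: m_le.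
exists x => //; apply/eqP; rewrite eq_le m_le // andbT mE lee_fin.
by apply: spread_le bx; rewrite ler0z.
Qed.
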